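(* Let $\mathcal{O}$ be a finite set, let $M_\emptyset \succ 0$ and $M_u \succeq 0$ ($u \in \mathcal{O}$) be real symmetric matrices of the same size, and for $\mathcal{X} \subseteq \mathcal{O}$ let $$Y(\mathcal{X}) = \Big( M_\emptyset + \sum_{u \in \mathcal{X}} M_u \Big)^{-1}, \qquad e(\mathcal{X}) = \| Y(\mathcal{X}) \|.$$ Then $e$ is $\epsilon$-supermodular for some $\epsilon$ satisfying $$\epsilon \leq \frac{\lambda_{\max}\big( \sum_{u \in \mathcal{O}} M_u \big)}{\lambda_{\min}[M_\emptyset]^2}.$$
   Context: For a set function $f : 2^{\mathcal{O}} \to \mathbb{R}$ and $u \in \mathcal{O} \setminus \mathcal{X}$, let $\Delta_u f(\mathcal{X}) = f(\mathcal{X}) - f(\mathcal{X} \cup \{u\})$. For $\epsilon \in \mathbb{R}$, $f$ is $\epsilon$-supermodular if $\Delta_u f(\mathcal{A}) \geq \Delta_u f(\mathcal{B}) - \epsilon$ for all sets $\mathcal{A} \subseteq \mathcal{B} \subseteq \mathcal{O}$ and all $u \in \mathcal{O} \setminus \mathcal{B}$. $\|\cdot\|$ is the spectral norm ($\ell_2$-induced norm); $\lambda_{\min}(\cdot)$ and $\lambda_{\max}(\cdot)$ denote the smallest and largest eigenvalues; $\succ 0$ and $\succeq 0$ denote positive definite and positive semidefinite. *)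

(* Defs.v *)
From mathcomp Require Import all_boot all_order all_algebra.
From mathcomp Require Import all_classical all_reals.
Set Implicit Arguments.
Unset Strict Implicit.
Unset Printing Implicit Defensive.
Import Order.TTheory GRing.Theory Num.Theory.
Local Open Scope ring_scope.

Definition posdefmx (R : realType) (n : nat) (A : 'M[R]_n) : Prop :=
  A \is symmetricmx /\
  forall x : 'cV[R]_n, x != 0 -> 0 < (x^T *m A *m x) ord0 ord0.

Definition possemidefmx (R : realType) (n : nat) (A : 'M[R]_n) : Prop :=
  A \is symmetricmx /\
  forall x : 'cV[R]_n, 0 <= (x^T *m A *m x) ord0 ord0.

(* The eigenvalue set is finite, and nonempty for a symmetric A of size n > 0,
   so these are then a minimum and a maximum. Outside this case they may take
   the default value 0. *)
Definition lambda_min (R : realType) (n : nat) (A : 'M[R]_n) : R :=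
  inf [set a : R | eigenvalue A a]%classic.

Definition lambda_max (R : realType) (n : nat) (A : 'M[R]_n) : R :=
  sup [set a : R | eigenvalue A a]%classic.

(* The library norm `|x| on matrices is the max norm, not this one. *)
Definition l2norm (R : realType) (n : nat) (x : 'cV[R]_n) : R :=
  Num.sqrt (\sum_(i < n) x i ord0 ^+ 2).

Definition spectral_norm (R : realType) (m n : nat) (A : 'M[R]_(m, n)) : R :=
  sup [set l2norm (A *m x) | x in [set x : 'cV[R]_n | l2norm x <= 1]]%classic.

Definition decrement (R : realType) (O : finType) (f : {set O} -> R)
    (u : O) (X : {set O}) : R :=
  f X - f (u |: X).

Definition supermodular_upto (R : realType) (O : finType) (eps : R)
    (f : {set O} -> R) : Prop :=
  forall A B : {set O}, A \subset B -> forall u : O, u \notin B ->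
    decrement f u A >= decrement f u B - eps.

Definition Ymx (R : realType) (O : finType) (n : nat)
    (M0 : 'M[R]_n) (M : O -> 'M[R]_n) (X : {set O}) : 'M[R]_n :=
  invmx (M0 + \sum_(u in X) M u).

(* Main.v *)
Require Import Defs.
From mathcomp Require Import all_boot all_order all_algebra.
From mathcomp Require Import all_classical all_reals.
From mathcomp Require Import ring lra.
Set Implicit Arguments.
Unset Strict Implicit.
Unset Printing Implicit Defensive.
Import Order.TTheory GRing.Theory Num.Theory.
Local Open Scope ring_scope.

(** Write S X for M0 + \sum_(u in X) M u, so that e X is the spectral norm of
    the inverse of S X.  Adding u to X increases S X in the Loewner order, hence
    decreases the norm of the inverse: every decrement of e is nonnegative
    ([spectral_norm_invmx_antimono]).  It therefore suffices to bound a single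
    decrement, the one at the larger set B, by
      eps = lambda_max (\sum_u M u) / lambda_min M0 ^+ 2.
    The resolvent identity
      (S B)^-1 = (S B + M u)^-1 + (S B)^-1 * M u * (S B + M u)^-1
    and the triangle inequality give
      e B - e (u |: B) <= |(S B)^-1| * |M u| * |(S B + M u)^-1|
    ([spectral_norm_invmx_sub_le]).  Both inverses have norm at most
    1 / lambda_min M0, because S X dominates M0 ([coercive_invmx_bound]), and
    M u has norm at most lambda_max (\sum_u M u), because the sum dominates
    each of its terms ([psd_bound]).

    Norms and eigenvalues are related without diagonalization, through
    the Cauchy-Schwarz inequality for a positive semidefinite form
    ([cauchy_schwarz_psd]).  What is needed from spectral theory is that the
    infimum of the Rayleigh quotient of a symmetric A is an eigenvalue
    ([sym_min_eigenvalue]); since every eigenvalue is a value of the Rayleigh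
    quotient, that infimum is lambda_min A. *)

(** * Inner product and Euclidean norm *)

Definition dotc (R : realType) (n : nat) (x y : 'cV[R]_n) : R :=
  (x^T *m y) ord0 ord0.

Section DotProduct.
Variables (R : realType) (n : nat).
Implicit Types (x y z : 'cV[R]_n) (A B : 'M[R]_n).

Lemma dotcE x y : dotc x y = \sum_i x i ord0 * y i ord0.
Proof. by rewrite /dotc mxE; apply: eq_bigr => i _; rewrite mxE. Qed.

Lemma dotcC x y : dotc x y = dotc y x.
Proof. by rewrite !dotcE; apply: eq_bigr => i _; rewrite mulrC. Qed.

Lemma dotcDr x y z : dotc x (y + z) = dotc x y + dotc x z.
Proof. by rewrite /dotc mulmxDr mxE. Qed.

Lemma dotcZr a x y : dotc x (a *: y) = a * dotc x y.
Proof. by rewrite /dotc -scalemxAr mxE. Qed.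

Lemma dotcDl x y z : dotc (y + z) x = dotc y x + dotc z x.
Proof. by rewrite dotcC dotcDr !(dotcC x). Qed.

Lemma dotcZl a x y : dotc (a *: x) y = a * dotc x y.
Proof. by rewrite dotcC dotcZr dotcC. Qed.

Lemma dotc_mulmx A x y : dotc (A *m x) y = dotc x (A^T *m y).
Proof. by rewrite /dotc trmx_mul mulmxA. Qed.

Lemma dotcxx_ge0 x : 0 <= dotc x x.
Proof. by rewrite dotcE sumr_ge0 // => i _; rewrite -expr2 sqr_ge0. Qed.

Lemma dotcxx_gt0 x : x != 0 -> 0 < dotc x x.
Proof.
move=> x0; rewrite lt_neqAle dotcxx_ge0 andbT eq_sym.
apply: contra x0 => /eqP; rewrite dotcE => /psumr_eq0P h.
apply/eqP/matrixP => i j; rewrite mxE ord1.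
have : x i ord0 * x i ord0 = 0 by apply: h => // k _; rewrite -expr2 sqr_ge0.
by move/eqP; rewrite mulf_eq0 orbb => /eqP.
Qed.

Lemma sqr_l2norm x : l2norm x ^+ 2 = dotc x x.
Proof.
rewrite /l2norm sqr_sqrtr; last by rewrite sumr_ge0 // => i _; rewrite sqr_ge0.
by rewrite dotcE; apply: eq_bigr => i _; rewrite expr2.
Qed.

Lemma l2norm_ge0 x : 0 <= l2norm x. Proof. exact: sqrtr_ge0. Qed.

Lemma l2norm0 : l2norm (0 : 'cV[R]_n) = 0.
Proof.
by rewrite /l2norm big1 ?sqrtr0 // => i _; rewrite mxE expr0n.
Qed.

Lemma l2norm_gt0 x : x != 0 -> 0 < l2norm x.
Proof.
move=> x0; rewrite lt_neqAle l2norm_ge0 andbT eq_sym.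
have := dotcxx_gt0 x0; rewrite -sqr_l2norm.
by apply: contraTneq => ->; rewrite expr0n ltxx.
Qed.

Lemma l2normZ a x : 0 <= a -> l2norm (a *: x) = a * l2norm x.
Proof.
move=> a0; apply/eqP; rewrite -(@eqrXn2 _ 2) ?mulr_ge0 ?l2norm_ge0 //.
by rewrite exprMn !sqr_l2norm dotcZl dotcZr mulrA -expr2.
Qed.

(** The choice t = - b / c minimizes the quadratic.  If c = 0 the polynomial is
    affine in t, and it stays nonnegative only if b = 0. *)
Lemma sqr_le_discriminant (a b c : R) : 0 <= c ->
  (forall t, 0 <= a + t * b *+ 2 + t ^+ 2 * c) -> b ^+ 2 <= a * c.
Proof.
rewrite le_eqVlt => /predU1P[<- | c0] h; last first.
  have := h (- b / c).
  have -> : a + - b / c * b *+ 2 + (- b / c) ^+ 2 * c = (a * c - b ^+ 2) / c.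
    by field; rewrite gt_eqF.
  by rewrite pmulr_lge0 ?invr_gt0 // subr_ge0.
have [->|b0] := eqVneq b 0; first by rewrite expr0n mulr0.
(* at this t the affine polynomial a + 2 b t takes the value -1 *)
have := h (- (a + 1) / (b *+ 2)).
have -> : a + - (a + 1) / (b *+ 2) * b *+ 2 + (- (a + 1) / (b *+ 2)) ^+ 2 * 0
          = -1 by field.
by rewrite oppr_ge0 ler10.
Qed.

(** The usual proof, from the nonnegative quadratic
    t |-> dotc (x + t *: y) (A *m (x + t *: y)), works for a degenerate form as
    well.  The identity matrix gives the Euclidean inequality [dotc_le]; other
    choices of A replace the square root of A in the operator bounds below. *)
Lemma cauchy_schwarz_psd A x y : A^T = A ->
  (forall z, 0 <= dotc z (A *m z)) ->
  dotc x (A *m y) ^+ 2 <= dotc x (A *m x) * dotc y (A *m y).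
Proof.
move=> symA psdA; apply: sqr_le_discriminant => // t.
have := psdA (x + t *: y); congr (0 <= _).
rewrite mulmxDr -scalemxAr !(dotcDl, dotcDr, dotcZl, dotcZr).
have -> : dotc y (A *m x) = dotc x (A *m y) by rewrite dotcC dotc_mulmx symA.
by ring.
Qed.

Lemma dotc_le x y : dotc x y <= l2norm x * l2norm y.
Proof.
apply: le_trans (ler_norm _) _.
rewrite -(@ler_pXn2r _ 2) ?nnegrE ?mulr_ge0 ?l2norm_ge0 //.
rewrite real_normK ?num_real // exprMn !sqr_l2norm.
have := @cauchy_schwarz_psd 1%:M x y (trmx1 _ _).
by rewrite !mul1mx; apply=> z; rewrite mul1mx dotcxx_ge0.
Qed.

Lemma l2norm_triangle x y : l2norm (x + y) <= l2norm x + l2norm y.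
Proof.
rewrite -(@ler_pXn2r _ 2) ?nnegrE ?addr_ge0 ?l2norm_ge0 //.
rewrite sqrrD !sqr_l2norm dotcDl !dotcDr (dotcC y x).
by have := dotc_le x y; lra.
Qed.

End DotProduct.

(** * Spectral norm, inverses and quadratic forms *)

Section OperatorBounds.
Variables (R : realType) (n : nat).
Implicit Types (x y z : 'cV[R]_n) (A B S T : 'M[R]_n).

(** The Frobenius norm of A is such a bound, by Cauchy-Schwarz on each row.
    It makes the supremum defining the spectral norm a genuine one. *)
Lemma ex_l2norm_bound A :
  exists2 K, 0 <= K & forall x, l2norm (A *m x) <= K * l2norm x.
Proof.
pose K2 := \sum_i dotc (row i A)^T (row i A)^T.
have K2_ge0 : 0 <= K2 by rewrite sumr_ge0 // => i _; rewrite dotcxx_ge0.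
exists (Num.sqrt K2); first exact: sqrtr_ge0.
move=> x; rewrite -(@ler_pXn2r _ 2) ?nnegrE ?mulr_ge0 ?l2norm_ge0 ?sqrtr_ge0 //.
rewrite exprMn !sqr_l2norm sqr_sqrtr // dotcE mulr_suml ler_sum // => i _.
have -> : (A *m x) i ord0 = dotc (row i A)^T x.
  by rewrite dotcE mxE; apply: eq_bigr => j _; rewrite !mxE.
rewrite -expr2.
have := @cauchy_schwarz_psd R n 1%:M (row i A)^T x (trmx1 _ _).
by rewrite !mul1mx; apply=> z; rewrite mul1mx dotcxx_ge0.
Qed.

Lemma l2norm_le_spectral_norm A x :
  l2norm x <= 1 -> l2norm (A *m x) <= spectral_norm A.
Proof.
move=> x1; have [K K0 hK] := ex_l2norm_bound A.
rewrite /spectral_norm; set E := (X in sup X).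
have ubE : has_ubound E.
  exists K => _ /= [z hz <-]; apply: le_trans (hK z) _.
  by rewrite -[leRHS]mulr1 ler_wpM2l.
by apply: (ub_le_sup ubE); exists x.
Qed.

Lemma spectral_norm_bound A x : l2norm (A *m x) <= spectral_norm A * l2norm x.
Proof.
have [->|x0] := eqVneq x 0; first by rewrite mulmx0 l2norm0 mulr0.
have nx := l2norm_gt0 x0.
rewrite -ler_pdivrMr // mulrC -l2normZ ?invr_ge0 ?(ltW nx) // scalemxAr.
apply: l2norm_le_spectral_norm.
by rewrite l2normZ ?invr_ge0 ?(ltW nx) // mulVf // gt_eqF.
Qed.

Lemma spectral_norm_le A K : 0 <= K ->
  (forall x, l2norm (A *m x) <= K * l2norm x) -> spectral_norm A <= K.
Proof.
move=> K0 hK; apply: ge_sup.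
  by exists (l2norm (A *m 0)), 0 => //=; rewrite l2norm0.
move=> _ /= [z hz <-]; apply: le_trans (hK z) _.
by rewrite -[leRHS]mulr1 ler_wpM2l.
Qed.

Lemma spectral_norm_ge0 A : 0 <= spectral_norm A.
Proof.
apply: le_trans (l2norm_ge0 (A *m 0)) _; apply: l2norm_le_spectral_norm.
by rewrite l2norm0.
Qed.

(** For x = invmx S *m y the hypothesis reads |x|^2 <= K <x, y>, which is at most
    K |x| |y|; divide by |x|. *)
Lemma coercive_invmx_bound S K : S \in unitmx -> 0 <= K ->
  (forall x, dotc x x <= K * dotc x (S *m x)) ->
  forall y, l2norm (invmx S *m y) <= K * l2norm y.
Proof.
move=> uS K0 hS y; have := hS (invmx S *m y); rewrite mulKVmx //.
set x := invmx S *m y => hx.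
have [->|x0] := eqVneq x 0; first by rewrite l2norm0 mulr_ge0 ?l2norm_ge0.
have nx := l2norm_gt0 x0.
rewrite -(ler_pM2r nx) -expr2 sqr_l2norm (le_trans hx) // -mulrA.
by rewrite ler_wpM2l // mulrC dotc_le.
Qed.

(** Converse of [coercive_invmx_bound] for positive semidefinite S.
    Cauchy-Schwarz for the form of S, applied to x and S^-1 x, gives
    |x|^4 <= <x, S x> <S^-1 x, x> <= <x, S x> K |x|^2. *)
Lemma invmx_bound_coercive S K : S^T = S -> S \in unitmx ->
  (forall x, 0 <= dotc x (S *m x)) ->
  (forall y, l2norm (invmx S *m y) <= K * l2norm y) ->
  forall x, dotc x x <= K * dotc x (S *m x).
Proof.
move=> symS uS psdS hK x.
have [->|x0] := eqVneq x 0; first by rewrite mulmx0 /dotc mulmx0 mxE mulr0.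
have xx := dotcxx_gt0 x0.
have := cauchy_schwarz_psd x (invmx S *m x) symS psdS.
rewrite mulKVmx // => cs.
have hinv : dotc (invmx S *m x) x <= K * dotc x x.
  apply: le_trans (dotc_le _ _) _; rewrite -sqr_l2norm expr2 mulrA.
  by rewrite ler_wpM2r ?l2norm_ge0.
rewrite -(ler_pM2r xx) -expr2; apply: le_trans cs _.
by rewrite [K * _]mulrC -mulrA ler_wpM2l.
Qed.

(** With y = A x, Cauchy-Schwarz for the form of A gives
    |y|^4 = <y, A x>^2 <= <y, A y> <x, A x> <= (L |y|^2) (L |x|^2). *)
Lemma psd_bound A L : A^T = A -> 0 <= L ->
  (forall x, 0 <= dotc x (A *m x)) ->
  (forall x, dotc x (A *m x) <= L * dotc x x) ->
  forall x, l2norm (A *m x) <= L * l2norm x.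
Proof.
move=> symA L0 psdA hL x; set y := A *m x.
have [->|y0] := eqVneq y 0; first by rewrite l2norm0 mulr_ge0 ?l2norm_ge0.
have yy := dotcxx_gt0 y0.
rewrite -(@ler_pXn2r _ 2) ?nnegrE ?mulr_ge0 ?l2norm_ge0 //.
rewrite exprMn !sqr_l2norm -(ler_pM2r yy) -expr2.
have -> : L ^+ 2 * dotc x x * dotc y y = (L * dotc y y) * (L * dotc x x) by ring.
apply: le_trans (cauchy_schwarz_psd y x symA psdA) _.
by rewrite ler_pM.
Qed.

(** A bound on the norm of S^-1 is a coercivity constant of S, which T inherits. *)
Lemma spectral_norm_invmx_antimono S T : S^T = S ->
  S \in unitmx -> T \in unitmx ->
  (forall x, 0 <= dotc x (S *m x)) ->
  (forall x, dotc x (S *m x) <= dotc x (T *m x)) ->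
  spectral_norm (invmx T) <= spectral_norm (invmx S).
Proof.
move=> symS uS uT psdS leST.
have K0 := spectral_norm_ge0 (invmx S).
apply: spectral_norm_le => //; apply: coercive_invmx_bound => // x.
apply: le_trans (ler_wpM2l K0 (leST x)).
exact: invmx_bound_coercive (spectral_norm_bound _) _.
Qed.

(** Resolvent identity and triangle inequality. *)
Lemma spectral_norm_invmx_sub_le S P c L : S \in unitmx -> S + P \in unitmx ->
  0 <= c -> 0 <= L ->
  (forall x, l2norm (invmx S *m x) <= c * l2norm x) ->
  (forall x, l2norm (invmx (S + P) *m x) <= c * l2norm x) ->
  (forall x, l2norm (P *m x) <= L * l2norm x) ->
  spectral_norm (invmx S) - spectral_norm (invmx (S + P)) <= L * c ^+ 2.
Proof.
move=> uS uSP c0 L0 hS hSP hP; rewrite lerBlDr addrC.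
apply: spectral_norm_le => [|x].
  by rewrite addr_ge0 ?spectral_norm_ge0 ?mulr_ge0 ?sqr_ge0.
have -> : invmx S *m x =
    invmx (S + P) *m x + invmx S *m (P *m (invmx (S + P) *m x)).
  apply: (can_inj (mulKmx uS)); rewrite mulmxDr !mulKVmx //.
  by rewrite -mulmxDl mulKVmx.
apply: le_trans (l2norm_triangle _ _) _.
rewrite mulrDl lerD ?spectral_norm_bound //.
apply: le_trans (hS _) _.
have -> : L * c ^+ 2 * l2norm x = c * (L * (c * l2norm x)) by ring.
rewrite ler_wpM2l //; apply: le_trans (hP _) _.
by rewrite ler_wpM2l.
Qed.

End OperatorBounds.

(** * Rayleigh quotients and extreme eigenvalues *)

Section ExtremeEigenvalues.
Variables (R : realType) (n : nat).
Implicit Types (x y z : 'cV[R]_n) (A B : 'M[R]_n).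

(** Eigenvectors in the definition of [eigenvalue] are rows, so the witness is
    a transpose. *)
Lemma eigenvalue_rayleigh A a : eigenvalue A a ->
  exists2 x, x != 0 & dotc x (A *m x) = a * dotc x x.
Proof.
case/eigenvalueP => v vA v0; exists v^T; first by rewrite trmx_eq0.
by rewrite /dotc trmxK mulmxA vA -scalemxAl mxE.
Qed.

Lemma not_unitmx_eigenvalue A a : A - a%:M \notin unitmx -> eigenvalue A a.
Proof. by rewrite /eigenvalue /eigenspace kermx_eq0 row_free_unit. Qed.

(** Let m be the infimum of <x, A x> over unit vectors; B = A - m is positive
    semidefinite.  If B were invertible, its inverse would be bounded and B
    would be coercive ([invmx_bound_coercive]), so <x, A x> would exceed m by a
    fixed positive amount on unit vectors.  Hence B is singular and m is an
    eigenvalue.  Compactness of the sphere is replaced by the boundedness of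
    B^-1. *)
Lemma sym_min_eigenvalue A : (0 < n)%N -> A^T = A ->
  exists2 m, eigenvalue A m & forall x, m * dotc x x <= dotc x (A *m x).
Proof.
move=> n_gt0 symA.
pose E := [set r | exists2 x, dotc x x = 1 & r = dotc x (A *m x)]%classic.
have E0 : (E !=set0)%classic.
  pose i0 := Ordinal n_gt0.
  pose e : 'cV[R]_n := delta_mx i0 ord0.
  exists (dotc e (A *m e)), e => //.
  rewrite dotcE (bigD1 i0) //= big1 => [|j ji]; rewrite !mxE ?eqxx.
    by rewrite mulr1 addr0.
  by rewrite (negPf ji) mulr0.
have lbE : has_lbound E.
  have [K K0 hK] := ex_l2norm_bound A.
  exists (- K) => _ [x x1 ->].
  have nx : l2norm x = 1.
    by apply/eqP; rewrite -(@eqrXn2 _ 2) ?l2norm_ge0 // sqr_l2norm x1 expr1n.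
  have := dotc_le (- 1 *: x) (A *m x).
  rewrite dotcZl mulN1r scaleN1r => h; rewrite lerNl; apply: le_trans h _.
  have -> : l2norm (- x) = 1.
    by rewrite -nx /l2norm; congr Num.sqrt; apply: eq_bigr => i _;
      rewrite mxE sqrrN.
  by rewrite mul1r (le_trans (hK x)) // nx mulr1.
pose m := inf E.
have lower x : m * dotc x x <= dotc x (A *m x).
  have [->|x0] := eqVneq x 0; first by rewrite mulmx0 /dotc mulmx0 mxE mulr0.
  have xx := dotcxx_gt0 x0; have nx := l2norm_gt0 x0.
  rewrite -ler_pdivlMr //; apply: (ge_inf lbE).
  exists ((l2norm x)^-1 *: x).
    by rewrite dotcZl dotcZr -sqr_l2norm expr2; field; rewrite gt_eqF.
  rewrite -scalemxAr dotcZl dotcZr -sqr_l2norm.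
  by field; rewrite gt_eqF.
exists m => //; apply: not_unitmx_eigenvalue; apply/negP => uB.
set B := A - m%:M in uB.
have formB x : dotc x (B *m x) = dotc x (A *m x) - m * dotc x x.
  by rewrite mulmxBl mul_scalar_mx -scaleNr dotcDr dotcZr mulNr.
have symB : B^T = B by rewrite /B linearB /= symA tr_scalar_mx.
have psdB x : 0 <= dotc x (B *m x) by rewrite formB subr_ge0.
have [K K0 hK] := ex_l2norm_bound (invmx B).
have coer := invmx_bound_coercive symB uB psdB hK.
have K_gt0 : 0 < K.
  rewrite lt_neqAle K0 andbT; apply/eqP => K_0.
  by have [_ [x x1 _]] := E0; have := coer x; rewrite -K_0 mul0r x1; lra.
(* coercivity of B lifts the infimum by 1 / K, which is absurd *)
have : m + K^-1 <= m.
  apply: lb_le_inf => // _ [x x1 ->].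
  have := coer x; rewrite formB x1 mulr1 -ler_pdivrMl // mulr1.
  by rewrite lerBrDl.
by rewrite gerDl leNgt invr_gt0 K_gt0.
Qed.

Lemma lambda_minP A : (0 < n)%N -> A^T = A ->
  eigenvalue A (lambda_min A) /\
  forall x, lambda_min A * dotc x x <= dotc x (A *m x).
Proof.
move=> n_gt0 symA; have [m em lm] := sym_min_eigenvalue n_gt0 symA.
suff -> : lambda_min A = m by [].
have lb : lbound [set a | eigenvalue A a]%classic m.
  move=> a /= /eigenvalue_rayleigh [x x0 ex].
  by have := lm x; rewrite ex ler_pM2r ?dotcxx_gt0.
apply/eqP; rewrite eq_le /lambda_min ge_inf //=; last by exists m.
by apply: lb_le_inf => //; exists m.
Qed.

Lemma lambda_max_lambda_min A : lambda_max A = - lambda_min (- A).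
Proof.
rewrite /lambda_max /lambda_min /inf opprK; congr sup.
apply/seteqP; split => a /=.
  move=> /eigenvalueP [v vA v0]; exists (- a); rewrite ?opprK //=.
  by apply/eigenvalueP; exists v; rewrite // mulmxN vA scaleNr.
case=> b /eigenvalueP [v vA v0] <-; apply/eigenvalueP; exists v => //.
by rewrite scaleNr -vA mulmxN opprK.
Qed.

Lemma lambda_max_ge A : (0 < n)%N -> A^T = A ->
  forall x, dotc x (A *m x) <= lambda_max A * dotc x x.
Proof.
move=> n_gt0 symA x; rewrite lambda_max_lambda_min.
have [|_ /(_ x)] := @lambda_minP (- A) n_gt0; first by rewrite linearN /= symA.
by rewrite mulNmx -(scaleN1r (A *m x)) dotcZr; lra.
Qed.

End ExtremeEigenvalues.

(** * Supermodularity of the spectral norm of the inverse *)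

Lemma symmetricmx_tr (R : realType) (n : nat) (A : 'M[R]_n) :
  A \is symmetricmx -> A^T = A.
Proof.
by move=> /is_hermitianmxP {2}->; rewrite expr0 scale1r map_mx_id.
Qed.

Lemma quadform_dotc (R : realType) (n : nat) (A : 'M[R]_n) (x : 'cV[R]_n) :
  (x^T *m A *m x) ord0 ord0 = dotc x (A *m x).
Proof. by rewrite /dotc mulmxA. Qed.

Lemma coercive_unitmx (R : realType) (n : nat) (A : 'M[R]_n) :
  (forall x, x != 0 -> 0 < dotc x (A *m x)) -> A \in unitmx.
Proof.
move=> pdA; apply: contraT => nA.
have /eigenvalue_rayleigh [x x0] : eigenvalue A 0.
  by apply: not_unitmx_eigenvalue; rewrite raddf0 subr0.
by rewrite mul0r => ex; have := pdA x x0; rewrite ex ltxx.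
Qed.

Theorem theorem4 (R : realType) (O : finType) (n : nat)
    (n_gt0 : (0 < n)%N) (M0 : 'M[R]_n) (M : O -> 'M[R]_n)
    (M0_posdef : posdefmx M0) (M_psd : forall u : O, possemidefmx (M u)) :
  exists eps : R,
    eps <= lambda_max (\sum_(u : O) M u) / lambda_min M0 ^+ 2 /\
    supermodular_upto eps (fun X : {set O} => spectral_norm (Ymx M0 M X)).
Proof.
set Msum := \sum_(u : O) M u; set L := lambda_max Msum.
exists (L / lambda_min M0 ^+ 2); split=> //.
have sym0 : M0^T = M0 by apply: symmetricmx_tr; case: M0_posdef.
have symM u : (M u)^T = M u by apply: symmetricmx_tr; case: (M_psd u).
have psdM u x : 0 <= dotc x (M u *m x).
  by rewrite -quadform_dotc; case: (M_psd u).
have [ev0 low0] := lambda_minP n_gt0 sym0.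
have lam_gt0 : 0 < lambda_min M0.
  have [x x0 ex] := eigenvalue_rayleigh ev0.
  case: M0_posdef => _ /(_ x x0); rewrite quadform_dotc ex.
  by rewrite pmulr_lgt0 ?dotcxx_gt0.
have formsum (P : pred O) x :
    dotc x ((\sum_(u | P u) M u) *m x) = \sum_(u | P u) dotc x (M u *m x).
  by rewrite /dotc mulmx_suml mulmx_sumr summxE.
have symsum (P : pred O) :
    (\sum_(u | P u) M u)^T = \sum_(u | P u) M u.
  by rewrite raddf_sum; apply: eq_bigr => u _; exact: symM.
have Lbound u x : dotc x (M u *m x) <= L * dotc x x.
  apply: le_trans (lambda_max_ge n_gt0 (symsum predT) x).
  by rewrite formsum (bigD1 u) //= lerDl sumr_ge0.
have L_ge0 : 0 <= L.
  have [x x0 _] := eigenvalue_rayleigh ev0.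
  rewrite -(pmulr_lge0 _ (dotcxx_gt0 x0)).
  apply: le_trans (lambda_max_ge n_gt0 (symsum predT) x).
  by rewrite formsum sumr_ge0.
pose S (X : {set O}) := M0 + \sum_(u in X) M u.
have symS X : (S X)^T = S X by rewrite /S linearD /= sym0 symsum.
have lowS X x : lambda_min M0 * dotc x x <= dotc x (S X *m x).
  apply: le_trans (low0 x) _.
  by rewrite mulmxDl dotcDr formsum lerDl sumr_ge0.
have psdS X x : 0 <= dotc x (S X *m x).
  by apply: le_trans (lowS X x); rewrite mulr_ge0 ?dotcxx_ge0 // ltW.
have uS X : S X \in unitmx.
  apply: coercive_unitmx => x x0; apply: lt_le_trans (lowS X x).
  by rewrite mulr_gt0 ?dotcxx_gt0.
have SU u (X : {set O}) : u \notin X -> S (u |: X) = S X + M u.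
  by move=> uX; rewrite /S big_setU1 //= [M u + _]addrC addrA.
have invS X x : l2norm (invmx (S X) *m x) <= (lambda_min M0)^-1 * l2norm x.
  apply: coercive_invmx_bound; first exact: uS.
    by rewrite invr_ge0 ltW.
  by move=> z; rewrite ler_pdivlMl.
move=> A B AB u uB.
have uA : u \notin A by apply: contra uB; apply: (fintype.subsetP AB).
have decA : 0 <= decrement (fun X => spectral_norm (Ymx M0 M X)) u A.
  rewrite subr_ge0 /Ymx -!/(S _).
  apply: spectral_norm_invmx_antimono (symS A) (uS A) (uS _) (psdS A) _ => x.
  by rewrite SU // (mulmxDl (S A)) dotcDr lerDl.
apply: le_trans decA; rewrite subr_le0 /decrement /Ymx -!/(S _) SU // -exprVn.
apply: spectral_norm_invmx_sub_le => //.
- by rewrite -SU //; exact: uS.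
- by rewrite invr_ge0 ltW.
- by rewrite -SU.
- exact: psd_bound (symM u) L_ge0 (psdM u) (Lbound u).
Qed.
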